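(* Let $\mathfrak g$ be a simple finite dimensional complex Lie algebra, $\delta:\mathfrak g[x]\to(\mathfrak g\otimes\mathfrak g)[x,y]$ a Lie bialgebra structure on $\mathfrak g[x]$ and $\overline\delta$ its extension to $\mathfrak g[[x]]$. Assume that $D(\mathfrak g[[x]],\overline\delta)=\mathfrak g((x))\oplus\mathfrak g$ with canonical form $(f_1+g_1|f_2+g_2)=t(K'(f_1,f_2))-K(g_1,g_2)$, where $t:\mathbb C((x))\to\mathbb C$ satisfies $t(x^k)=0$ for $k\ge1$, $t(1)=1$, $t(x^{-k})=b_k$ for $k\ge1$, and put $b(x)=1+b_1x+b_2x^2+\cdots$. Let $\mathfrak g((x))\oplus\mathfrak g=\mathfrak g[[x]]\oplus W$ be the corresponding Manin triple. Assume that $\sigma(x)\in\mathrm{Aut}_{\mathbb C[x]}(\mathfrak g[x])$ and a vertex $\alpha_i$ of the extended Dynkin diagram of $\mathfrak g$ are such that $$\sigma(x)\bigl(W(\mathbb C[[x^{-1}]]\oplus\mathbb C)\bigr)\subset\mathbb O_{\alpha_i}\oplus\mathfrak g.$$ Then $\frac1{b(x)}$ is a polynomial of degree at most $1$ if $k_i=1$, and $b(x)=1$ if $k_i>1$.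
   Context: Lie bialgebra structure: $\delta:L\to L\otimes L$ is a derivation into the $L$-module $L\otimes L$ inducing a Lie algebra structure on the dual space. For $L=\mathfrak g[[x]]$ one uses the topological tensor square $(\mathfrak g\otimes\mathfrak g)[[x,y]]$ and $L^*=$ the space of distributions (functionals vanishing on $x^m\mathfrak g[[x]]$ for some $m$). A structure $\delta$ on $\mathfrak g[x]$ extends to $\mathfrak g[[x]]$ by $\overline\delta(\sum a_nx^n)=\sum\delta(a_nx^n)$. The Drinfeld double $D(L,\delta)=L\oplus L^*$ carries the symmetric form with $L,L^*$ isotropic and $(a|f)=f(a)$, and the unique Lie bracket extending those of $L$ and $L^*$ and making the form invariant. The equality $D(\mathfrak g[[x]],\overline\delta)=\mathfrak g((x))\oplus\mathfrak g$ (direct sum of Lie algebras) is an isomorphism preserving forms (up to a nonzero scalar), under which $\mathfrak g[[x]]$ is embedded by $f\mapsto(f,f(0))$. $K$ is the Killing form of $\mathfrak g$, $K'$ that of $\mathfrak g((x))$ over $\mathbb C((x))$. $W$ is the image of $\mathfrak g[[x]]^*$: a Lagrangian subalgebra ($W=W^\perp$) complementary to $\mathfrak g[[x]]$. It is known that $W\subset x^N\mathfrak g[x^{-1}]\oplus\mathfrak g$ for some $N$, so $W\subset\mathfrak g((x^{-1}))\oplus\mathfrak g$; $W(\mathbb C[[x^{-1}]]\oplus\mathbb C)$ is the span of products of elements of $W$ with elements of the ring $\mathbb C[[x^{-1}]]\oplus\mathbb C$ acting componentwise. A $\mathbb C[x]$-linear Lie automorphism $\sigma(x)$ of $\mathfrak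 g[x]$ acts naturally on $\mathfrak g((x^{-1}))$ and by $\sigma(0)$ on the summand $\mathfrak g$. Fix a Cartan subalgebra $\mathfrak h$, root system $R$, simple roots $\alpha_1,\dots,\alpha_\ell$ ($\ell=\mathrm{rank}\,\mathfrak g$), maximal root $\alpha_{\max}=\sum_{j\ge1}k_j\alpha_j$, $\alpha_0=-\alpha_{\max}$, $k_0=1$. For $h\in\mathfrak h(\mathbb R)$ put $\mathbb O_h=\mathfrak h[[x^{-1}]]\oplus\bigoplus_{\alpha\in R}M_\alpha(h)\mathfrak g_\alpha$, where $M_\alpha(h)=\{f\in\mathbb C((x^{-1})):v(f)\ge\alpha(h)\}$ and $v(\sum_{k\ge n}a_kx^{-k})=n$ if $a_n\ne0$. Let $h_0=0$ and, for $i\ge1$, let $h_i$ be defined by $\alpha_j(h_i)=\delta_{ij}/k_i$ ($j\ge1$). Then $\mathbb O_{\alpha_i}:=\mathbb O_{h_i}$. *)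

(* Defs.v *)
From HB Require Import structures.
From mathcomp Require Import all_boot all_order all_algebra.
From mathcomp Require Export complex.
From mathcomp Require Import all_classical all_reals.

Set Implicit Arguments.
Unset Strict Implicit.
Unset Printing Implicit Defensive.
Import Order.TTheory GRing.Theory Num.Theory.

Local Open Scope classical_set_scope.
Local Open Scope ring_scope.

(* Series are coefficient functions.  V[[x]] is the type [nat -> V], with
   V[x] a subset of it; V((x)) and V((x^-1)) are both subsets of the type
   [int -> V], where [f n] is the coefficient of x^n.  The set of x^n with
   nonzero coefficient may be infinite in both directions in [int -> V];
   \sum_(i \in A) is the sum of a finitely supported family. *)

Section LieAlgebra.
Variables (K : fieldType) (V : lmodType K).

Definition linear_on (U : lmodType K) (A : set V) (f : V -> U) : Prop :=
  forall a x y, A x -> A y -> f (a *: x + y) = a *: f x + f y.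

Record lie_bracket_on (A : set V) (br : V -> V -> V) : Prop := {
  lie_closed : forall x y, A x -> A y -> A (br x y);
  lie_linearl : forall z, A z -> linear_on A (br^~ z);
  lie_linearr : forall z, A z -> linear_on A (br z);
  lie_alternating : forall x, A x -> br x x = 0;
  lie_jacobi : forall x y z, A x -> A y -> A z ->
    br x (br y z) + br y (br z x) + br z (br x y) = 0 }.

Definition linear_span (S : set V) : set V :=
  [set u | exists n (c : 'I_n -> K) (s : 'I_n -> V),
     (forall k, S (s k)) /\ u = \sum_(k < n) c k *: s k].

End LieAlgebra.

Section Series.
Variables (K : fieldType) (V : lmodType K).

Definition mono (n : nat) (a : V) : nat -> V := fun m => if m == n then a else 0.

Definition polynomials : set (nat -> V) :=
  [set f | exists N : nat, forall n, (N <= n)%N -> f n = 0].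

Definition laurent : set (int -> V) :=
  [set f | exists N : int, forall n, n < N -> f n = 0].

Definition laurent_inv : set (int -> V) :=
  [set f | exists N : int, forall n, N < n -> f n = 0].

Definition power_inv : set (int -> V) := [set f | forall n, 0 < n -> f n = 0].

Definition fps_to_fls (f : nat -> V) : int -> V :=
  fun n => if n is Posz m then f m else 0.

End Series.

Section Products.
Variables (K : fieldType) (U V W : lmodType K) (op : U -> V -> W).

Definition fps_conv (f : nat -> U) (h : nat -> V) : nat -> W :=
  fun n => \sum_(i < n.+1) op (f i) (h (n - i)%N).

Definition fls_conv (f : int -> U) (h : int -> V) : int -> W :=
  fun n => \sum_(i \in [set: int]) op (f i) (h (n - i)).

End Products.

Section CurrentAlgebra.
Variables (R : realType) (g : vectType R[i]) (br : g -> g -> g).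

Local Notation C := R[i].
Local Notation dim := (\dim {:g}).
Local Notation e := (vbasis {:g}).

Definition simple_lie : Prop :=
  [/\ lie_bracket_on [set: g] br,
      (exists x y, br x y != 0)
    & forall U : {vspace g}, (forall x u, u \in U -> br x u \in U) ->
        U = 0%VS \/ U = fullv].

Definition killing (a b : g) : C :=
  \sum_(p < dim) coord e p (br a (br b e`_p)).

Definition fps_br : (nat -> g) -> (nat -> g) -> (nat -> g) :=
  fps_conv (U := g) (V := g) (W := g) br.
Definition fls_br : (int -> g) -> (int -> g) -> (int -> g) :=
  fls_conv (U := g) (V := g) (W := g) br.

(* The trace of (ad f1) (ad f2) over the field C((x)), computed in the
   C((x))-basis of g((x)) made of the constant series e_p. *)
Definition killing_laurent (f1 f2 : int -> g) : int -> C := fun n =>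
  \sum_(p < dim)
    coord e p (fls_br f1 (fls_br f2 (fps_to_fls (mono 0 e`_p))) n).

(* g (x) g is modelled by matrices: the (p, q) entry is the coordinate on
   e_p (x) e_q.  An element T of (g (x) g)[[x, y]] has T i j as coefficient
   of x^i y^j. *)
Definition tens := 'M[C]_dim.

Definition tensor (a b : g) : tens := \matrix_(p, q) (coord e p a * coord e q b).

Definition ad_left (a : g) (T : tens) : tens :=
  \sum_(p < dim) \sum_(q < dim) T p q *: tensor (br a e`_p) e`_q.
Definition ad_right (a : g) (T : tens) : tens :=
  \sum_(p < dim) \sum_(q < dim) T p q *: tensor e`_p (br a e`_q).

(* f . T = [f(x) (x) 1 + 1 (x) f(y), T(x, y)] *)
Definition tens_act (f : nat -> g) (T : nat -> nat -> tens) :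
    nat -> nat -> tens := fun i j =>
  \sum_(p < i.+1) ad_left (f p) (T (i - p)%N j) +
  \sum_(q < j.+1) ad_right (f q) (T i (j - q)%N).

Definition polynomials2 : set (nat -> nat -> tens) :=
  [set T | exists N : nat, forall i j, (N <= i)%N || (N <= j)%N -> T i j = 0].

(* (phi (x) psi)(T); the family is finitely supported when T is a polynomial,
   and when phi and psi are distributions. *)
Definition tens_eval (phi psi : (nat -> g) -> C) (T : nat -> nat -> tens) : C :=
  \sum_(ij \in [set: nat * nat])
    \sum_(p < dim) \sum_(q < dim)
      T ij.1 ij.2 p q * phi (mono ij.1 e`_p) * psi (mono ij.2 e`_q).

Definition dual_br (delta : (nat -> g) -> (nat -> nat -> tens))
    (phi psi : (nat -> g) -> C) : (nat -> g) -> C :=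
  fun f => tens_eval phi psi (delta f).

Definition poly_dual : set ((nat -> g) -> C) :=
  [set phi | linear_on (U := C^o) (polynomials (V := g)) phi].

(* Equalities in the dual of g[x] are tested on g[x] only; the bilinearity
   of [dual_br delta] needs no axiom. *)
Record lie_bialgebra_poly (delta : (nat -> g) -> (nat -> nat -> tens)) : Prop := {
  delta_poly : forall f, polynomials f -> polynomials2 (delta f);
  delta_linear : forall (a : C) f h, polynomials f -> polynomials h ->
    forall i j, delta (a *: f + h) i j = a *: delta f i j + delta h i j;
  delta_derivation : forall f h, polynomials f -> polynomials h ->
    forall i j, delta (fps_br f h) i j =
      tens_act f (delta h) i j - tens_act h (delta f) i j;
  delta_alternating : forall phi f, poly_dual phi -> polynomials f ->
    dual_br delta phi phi f = 0;
  delta_jacobi : forall phi psi chi f,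
    poly_dual phi -> poly_dual psi -> poly_dual chi -> polynomials f ->
    dual_br delta phi (dual_br delta psi chi) f +
    dual_br delta psi (dual_br delta chi phi) f +
    dual_br delta chi (dual_br delta phi psi) f = 0 }.

(* The sum of the delta (a_n x^n); it converges in (g (x) g)[[x, y]], so each
   coefficient is a finitely supported sum. *)
Definition delta_ext (delta : (nat -> g) -> (nat -> nat -> tens)) :
    (nat -> g) -> (nat -> nat -> tens) := fun f i j =>
  \sum_(n \in [set: nat]) delta (mono n (f n)) i j.

Definition distributions : set ((nat -> g) -> C) :=
  [set phi | scalar phi /\
     exists m : nat, forall f, (forall n, (n < m)%N -> f n = 0) -> phi f = 0].

Definition double_type := ((nat -> g) * ((nat -> g) -> C^o))%type.

Definition double : set double_type := [set u | distributions u.2].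

Definition double_form (u v : double_type) : C := v.2 u.1 + u.2 v.1.

(* The axioms determine brD on the double. *)
Record double_bracket (delta : (nat -> g) -> (nat -> nat -> tens))
    (brD : double_type -> double_type -> double_type) : Prop := {
  double_lie : lie_bracket_on double brD;
  double_extl : forall f h, brD (f, 0) (h, 0) = (fps_br f h, 0);
  double_extr : forall phi psi, distributions phi -> distributions psi ->
    brD (0, phi) (0, psi) = (0, dual_br (delta_ext delta) phi psi);
  double_invariant : forall u v w, double u -> double v -> double w ->
    double_form (brD u v) w = double_form u (brD v w) }.

Definition target : set ((int -> g) * g) := [set u | laurent u.1].

Definition target_br (u v : (int -> g) * g) : (int -> g) * g :=
  (fls_br u.1 v.1, br u.2 v.2).

Definition xpow (n : int) : int -> C := fun m => (m == n)%:R.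

Definition target_form (t : (int -> C) -> C) (u v : (int -> g) * g) : C :=
  t (killing_laurent u.1 v.1) - killing u.2 v.2.

Record double_iso (t : (int -> C) -> C)
    (brD : double_type -> double_type -> double_type)
    (Phi : double_type -> (int -> g) * g) : Prop := {
  iso_bij : set_bij double target Phi;
  iso_linear : linear_on double Phi;
  iso_br : forall u v, double u -> double v ->
    Phi (brD u v) = target_br (Phi u) (Phi v);
  iso_form : exists2 c : C, c != 0 & forall u v, double u -> double v ->
    target_form t (Phi u) (Phi v) = c * double_form u v;
  iso_embed : forall f, Phi (f, 0) = (fps_to_fls f, f 0%N) }.

Definition manin_complement (Phi : double_type -> (int -> g) * g) :
    set ((int -> g) * g) :=
  [set Phi (0, phi) | phi in distributions].

(* W (C[[x^-1]] (+) C) *)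
Definition ring_span (W : set ((int -> g) * g)) : set ((int -> g) * g) :=
  linear_span [set u | exists w (r : int -> C) (c : C),
    [/\ W w, power_inv (V := C^o) r &
        u = (fls_conv (U := C^o) (V := g) (W := g) *:%R r w.1, c *: w.2)]].

Definition poly_scale (p : {poly C}) (f : nat -> g) : nat -> g :=
  fps_conv (U := C^o) (V := g) (W := g) *:%R (fun n => p`_n) f.

Record poly_automorphism (sigma : (nat -> g) -> (nat -> g)) : Prop := {
  aut_bij : set_bij (polynomials (V := g)) (polynomials (V := g)) sigma;
  aut_linear : forall p f h, polynomials f -> polynomials h ->
    sigma (poly_scale p f + h) = poly_scale p (sigma f) + sigma h;
  aut_br : forall f h, polynomials f -> polynomials h ->
    sigma (fps_br f h) = fps_br (sigma f) (sigma h) }.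

(* The C((x^-1))-linear extension: sum a_n x^n goes to sum sigma(a_n) x^n.
   The sums are finitely supported because the degrees of the sigma(a), for a
   in g, are bounded. *)
Definition aut_fls (sigma : (nat -> g) -> (nat -> g)) (f : int -> g) : int -> g :=
  fun n => \sum_(k \in [set: nat]) sigma (mono 0 (f (n - k%:Z))) k.

Definition aut_at0 (sigma : (nat -> g) -> (nat -> g)) (a : g) : g :=
  sigma (mono 0 a) 0%N.

Definition aut_act (sigma : (nat -> g) -> (nat -> g)) (u : (int -> g) * g) :
    (int -> g) * g := (aut_fls sigma u.1, aut_at0 sigma u.2).

Definition brv (U V : {vspace g}) : {vspace g} :=
  <<[seq br u v | u <- vbasis U, v <- vbasis V]>>%VS.

Definition cartan (H : {vspace g}) : Prop :=
  [/\ (brv H H <= H)%VS,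
      (exists n : nat, iter n (brv H) H = 0%VS)
    & forall x, (forall h, h \in H -> br x h \in H) -> x \in H].

Section Roots.
Variable H : {vspace g}.

Local Notation dual := 'Hom(subvs_of H, C^o).

Definition root_space (alpha : dual) : set g :=
  [set x | forall h : subvs_of H, br (vsval h) x = (alpha h : C) *: x].

Definition roots : set dual :=
  [set alpha | alpha != 0 /\ exists2 x, x != 0 & root_space alpha x].

(* alpha 0, ..., alpha l and k 0, ..., k l label the vertices of the extended
   Dynkin diagram: [lift ord0 j] runs over the l simple roots, and
   - alpha 0 is the maximal root. *)
Record extended_base (alpha : 'I_(\dim H).+1 -> dual)
    (k : 'I_(\dim H).+1 -> nat) : Prop := {
  base_roots : forall j, roots (alpha (lift ord0 j));
  base_basis : basis_of fullv [seq alpha (lift ord0 j) | j <- enum 'I_(\dim H)];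
  base_sign : forall beta, roots beta -> exists m : 'I_(\dim H) -> nat,
    beta = \sum_j (m j)%:R *: alpha (lift ord0 j) \/
    beta = - \sum_j (m j)%:R *: alpha (lift ord0 j);
  base_max_root : roots (- alpha ord0);
  base_max : forall beta, roots beta -> exists m : 'I_(\dim H) -> nat,
    - alpha ord0 - beta = \sum_j (m j)%:R *: alpha (lift ord0 j);
  base_max_coef :
    - alpha ord0 = \sum_j (k (lift ord0 j))%:R *: alpha (lift ord0 j);
  base_k0 : k ord0 = 1%N }.

Definition vertex_point (alpha : 'I_(\dim H).+1 -> dual)
    (k : 'I_(\dim H).+1 -> nat) (i : 'I_(\dim H).+1) (h : subvs_of H) : Prop :=
  if i == ord0 then h = 0
  else forall j, j != ord0 -> alpha j h = (i == j)%:R / (k i)%:R.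

(* v(f) = n; it holds for no n when f = 0 *)
Definition valuation_is (f : int -> C) (n : int) : Prop :=
  f (- n) != 0 /\ forall m : int, m < n -> f (- m) = 0.

(* M_alpha(h), for r = alpha(h); the order of R[i] restricts to the usual one
   on real numbers. *)
Definition val_ge (r : C) : set (int -> C) :=
  [set f | laurent_inv (V := C^o) f /\ forall n, valuation_is f n -> r <= n%:~R].

(* Each g_alpha is a line, so M_alpha(h) g_alpha is the set of products. *)
Definition order_at (h : subvs_of H) : set (int -> g) :=
  [set F | exists (F0 : int -> g) (f : dual -> (int -> C)) (u : dual -> g),
    [/\ power_inv F0 /\ (forall n, F0 n \in H),
        (forall alpha, roots alpha ->
           val_ge (alpha h) (f alpha) /\ root_space alpha (u alpha))
      & F = F0 + \sum_(alpha \in roots) (fun n : int => f alpha n *: u alpha)]].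

End Roots.

End CurrentAlgebra.

Definition fps_mul (K : fieldType) : (nat -> K) -> (nat -> K) -> (nat -> K) :=
  fps_conv (U := K^o) (V := K^o) (W := K^o) *%R.

Definition fps_one (K : fieldType) : nat -> K := fun n => (n == 0%N)%:R.

(* Main.v *)
(* In the double, g[[x]]^* is its own orthogonal, so W = W^perp.  Let e be a
   root vector of weight beta and a = sigma^-1(e), which lies in g[x].  As sigma
   preserves K', t extracts the coefficient of x^0 of the product with b, and
   K(e, F) involves only the (-beta)-component of F, the element x^(m-1) a / b is
   orthogonal to W as soon as O_h has no x^(1-m) term in weight -beta.  Hence it
   lies in W, and its image x^(m-1) e / b lies in O_h, which bounds the degree of
   1/b: by 1 if beta(h) is an integer, by 0 if 0 < beta(h) < 1.  Take beta the
   maximal root if i = 0, and beta = alpha_i otherwise. *)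
Require Import Defs.
From HB Require Import structures.
From mathcomp Require Import all_boot all_order all_algebra.
From mathcomp Require Import all_classical all_reals.
From mathcomp Require Import zify.

Set Implicit Arguments.
Unset Strict Implicit.
Unset Printing Implicit Defensive.
Import Order.TTheory GRing.Theory Num.Theory.

Local Open Scope classical_set_scope.
Local Open Scope ring_scope.

(** * Triangular double sums and the inverse of a power series *)

Lemma big_triangle (V : zmodType) (F : nat -> nat -> V) (L : nat) :
  \sum_(s < L) \sum_(q < s.+1) F q (s - q)%N =
  \sum_(q < L) \sum_(l < L - q) F q l.
Proof.
elim: L => [|L IH]; first by rewrite !big_ord0.
rewrite big_ord_recr /= IH [RHS]big_ord_recr /= subSnn big_ord1.
rewrite [X in _ + X]big_ord_recr /= subnn addrA -big_split /=; congr (_ + _).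
by apply: eq_bigr => q _; rewrite subSn ?(ltnW (ltn_ord q)) // big_ord_recr.
Qed.

Lemma exchange_triangle (V : zmodType) (F : nat -> nat -> V) (L : nat) :
  \sum_(q < L) \sum_(l < L - q) F q l = \sum_(l < L) \sum_(q < L - l) F q l.
Proof.
rewrite -(big_triangle F) -(big_triangle (fun l q => F q l)).
apply: eq_bigr => s _; rewrite (reindex_inj rev_ord_inj) /=.
by apply: eq_bigr => q _; rewrite subSS subKn // -ltnS.
Qed.

Lemma fps_inverse (K : fieldType) (b : nat -> K) :
  b 0%N = 1 -> exists c : nat -> K, fps_mul b c = @fps_one K.
Proof.
move=> b0.
(* [s n] lists the first n coefficients of 1/b. Each coefficient depends on all the earlier ones, so
   the recursion builds whole lists. *)
pose fix s n : seq K := if n is n'.+1 then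
  rcons (s n') ((n' == 0%N)%:R - \sum_(i < n') b i.+1 * (s n')`_(n' - i.+1)) else [::].
have ss n : size (s n) = n by elim: n => //= n IH; rewrite size_rcons IH.
have sE n m : (m < n)%N -> (s n)`_m = (s m.+1)`_m.
  elim: n => // n IH; rewrite ltnS leq_eqVlt => /orP[/eqP->//|lt_mn].
  by rewrite [s n.+1]/= nth_rcons ss lt_mn IH.
exists (fun n => (s n.+1)`_n); apply/funext => n.
rewrite /fps_mul /fps_conv /fps_one big_ord_recl b0 mul1r subn0.
rewrite [s n.+1]/= nth_rcons ss ltnn eqxx -addrA [X in _ + X](_ : _ = 0) ?addr0 //.
apply/eqP; rewrite addrC subr_eq0; apply/eqP; apply: eq_bigr => i _.
by rewrite [RHS]/= sE ?ltn_subrL //; case: (n) i => [[]|].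
Qed.

(** * The bracket and the Killing form as a matrix trace *)

Section Lie.
Variables (R : realType) (g : vectType R[i]) (br : g -> g -> g).
Hypothesis brP : lie_bracket_on [set: g] br.

Local Notation C := R[i].
Local Notation dim := (\dim {:g}).
Local Notation e := (vbasis {:g}).
Local Notation K := (killing br).

Lemma br_linr x : linear (br x).
Proof. by move=> a y z; apply: (lie_linearr brP). Qed.

Lemma br_linl y : linear (br^~ y).
Proof. by move=> a x z; apply: (lie_linearl brP). Qed.

Lemma br0 x : br x 0 = 0.
Proof. by have /eqP := br_linr x (-1) 0 0; rewrite !scaleN1r oppr0 addr0 addNr => /eqP. Qed.

Lemma brZ a x y : br x (a *: y) = a *: br x y.
Proof. by have := br_linr x a y 0; rewrite br0 !addr0. Qed.

Lemma brD x y z : br x (y + z) = br x y + br x z.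
Proof. by have := br_linr x 1 y z; rewrite !scale1r. Qed.

Lemma br_sum x I (s : seq I) (P : pred I) (F : I -> g) :
  br x (\sum_(i <- s | P i) F i) = \sum_(i <- s | P i) br x (F i).
Proof. exact: (big_morph (br x) (brD x) (br0 x)). Qed.

Lemma brC x y : br x y = - br y x.
Proof.
apply/eqP; rewrite -addr_eq0; apply/eqP.
have := lie_alternating brP (x := x + y) I.
have brDl u v w : br (u + v) w = br u w + br v w.
  by have := br_linl w 1 u v; rewrite !scale1r.
by rewrite brD !brDl !(lie_alternating brP I) add0r addr0 addrC.
Qed.

Lemma br0l x : br 0 x = 0.
Proof. by rewrite brC br0 oppr0. Qed.

Lemma br_jacobi x y z : br (br x y) z = br x (br y z) - br y (br x z).
Proof.
have := lie_jacobi brP (x := x) (y := y) (z := z) I I I.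
rewrite [br z (br x y)]brC [br z x]brC -[- br x z]scaleN1r brZ scaleN1r => /eqP.
by rewrite subr_eq0 => /eqP <-.
Qed.

Definition coords (x : g) : 'rV[C]_dim := \row_p coord e p x.

(** Coordinates are rows, so this matrix of ad x acts on the right, and products of matrices reverse
    the order of composition. *)
Definition adm (x : g) : 'M[C]_dim := \matrix_(p, q) coord e q (br x e`_p).

Lemma sum_coord x : x = \sum_p coord e p x *: e`_p.
Proof. by rewrite -coord_vbasis // memvf. Qed.

Lemma coords_inj : injective coords.
Proof.
move=> x y /rowP xy; rewrite (sum_coord x) (sum_coord y).
by apply: eq_bigr => p _; have := xy p; rewrite !mxE => ->.
Qed.

Lemma coords_adm x y : coords (br x y) = coords y *m adm x.
Proof.
apply/rowP => q; rewrite !mxE {1}(sum_coord y) br_sum linear_sum.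
by apply: eq_bigr => p _; rewrite brZ linearZ !mxE.
Qed.

Lemma killing_tr x y : K x y = \tr (adm y *m adm x).
Proof.
apply: eq_bigr => p _; rewrite !mxE; have /rowP/(_ p) := coords_adm x (br y e`_p).
rewrite !mxE => ->; apply: eq_bigr => q _; by rewrite !mxE.
Qed.

Lemma adm_br x y : adm (br x y) = adm y *m adm x - adm x *m adm y.
Proof.
apply/row_matrixP => p.
have rE z : row p (adm z) = coords (br z e`_p) by apply/rowP=> q; rewrite !mxE.
rewrite linearB /= !row_mul !rE -!coords_adm br_jacobi.
by apply/rowP => q; rewrite !mxE linearB.
Qed.

(** Both sides expand into two traces of triple products, which agree up to cyclic permutation. *)
Lemma killing_inv x y z : K (br x y) z = K x (br y z).
Proof.
rewrite !killing_tr !adm_br mulmxBr mulmxBl !linearB /= !mulmxA; congr (_ - _).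
by rewrite mxtrace_mulC !mulmxA.
Qed.

Lemma adm_lin : linear adm.
Proof.
by move=> a x y; apply/matrixP=> p q; rewrite !mxE (br_linl _ a) !linearE.
Qed.

HB.instance Definition _ := GRing.isLinear.Build _ _ _ _ adm adm_lin.

Lemma killing0r x : K x 0 = 0.
Proof. by rewrite killing_tr linear0 mul0mx linear0. Qed.

Lemma killing0l x : K 0 x = 0.
Proof. by rewrite killing_tr linear0 mulmx0 linear0. Qed.

Lemma killingDr x y z : K x (y + z) = K x y + K x z.
Proof. by rewrite !killing_tr linearD mulmxDl linearD. Qed.

Lemma killingZr a x y : K x (a *: y) = a * K x y.
Proof. by rewrite !killing_tr linearZ -scalemxAl linearZ. Qed.

Lemma killingZl a x y : K (a *: x) y = a * K x y.
Proof. by rewrite !killing_tr linearZ -scalemxAr linearZ. Qed.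

Lemma killing_sumr x I (s : seq I) (P : pred I) (F : I -> g) :
  K x (\sum_(i <- s | P i) F i) = \sum_(i <- s | P i) K x (F i).
Proof.
rewrite killing_tr linear_sum mulmx_suml linear_sum.
by apply: eq_bigr => i _; rewrite killing_tr.
Qed.

Lemma killing_suml x I (s : seq I) (P : pred I) (F : I -> g) :
  K (\sum_(i <- s | P i) F i) x = \sum_(i <- s | P i) K (F i) x.
Proof.
rewrite killing_tr linear_sum mulmx_sumr linear_sum.
by apply: eq_bigr => i _; rewrite killing_tr.
Qed.

End Lie.

(** * The free C[x]-module g[x] as row vectors of polynomials *)

Section PolynomialModule.
Variables (R : realType) (g : vectType R[i]).

Local Notation C := R[i].
Local Notation dim := (\dim {:g}).
Local Notation e := (vbasis {:g}).

Definition curve (v : 'rV[{poly C}]_dim) : nat -> g :=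
  fun s => \sum_q (v 0 q)`_s *: e`_q.

Lemma coord_curve v s q : coord e q (curve v s) = (v 0 q)`_s.
Proof. by rewrite coord_sum_free // (basis_free (vbasisP _)). Qed.

Lemma curve_inj : injective curve.
Proof.
move=> v w vw; apply/rowP => q; apply/polyP => s.
by rewrite -!coord_curve vw.
Qed.

Lemma curve_poly v : polynomials (curve v).
Proof.
exists (\max_q size (v ord0 q))%N => n le_n; apply: big1 => q _.
by rewrite nth_default ?scale0r // (leq_trans _ le_n) // (leq_bigmax q).
Qed.

Lemma curve_surj f : polynomials f -> exists v, f = curve v.
Proof.
move=> [N fN]; exists (\row_q \poly_(s < N) coord e q (f s)); apply/funext => s.
rewrite {1}(sum_coord (f s)); apply: eq_bigr => q _; rewrite mxE coef_poly.
by case: ltnP => // /fN ->; rewrite linear0.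
Qed.

Lemma curve_scale p v w : curve (p *: v + w) = poly_scale p (curve v) + curve w.
Proof.
apply/funext => s; rewrite /curve /poly_scale /fps_conv addrfctE.
under [X in _ = X + _]eq_bigr do rewrite scaler_sumr.
rewrite exchange_big -big_split; apply: eq_bigr => q _ /=.
rewrite !mxE coefD coefM scalerDl scaler_suml; congr (_ + _).
by apply: eq_bigr => i _; rewrite scalerA.
Qed.

Lemma curve0 : curve 0 = 0.
Proof. by apply/funext => s; apply: big1 => q _; rewrite mxE coef0 scale0r. Qed.

Lemma curveZ p v : curve (p *: v) = poly_scale p (curve v).
Proof. by rewrite -[p *: v]addr0 curve_scale curve0 addr0. Qed.

Lemma curve_delta q : curve (delta_mx 0 q) = mono 0 e`_q.
Proof.
apply/funext => s; rewrite /curve /mono (bigD1 q) //= mxE !eqxx coef1 big1 => [|p pq].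
  by case: eqP => _; rewrite ?scale1r ?scale0r addr0.
by rewrite mxE (negPf pq) andbF coef0 scale0r.
Qed.

Lemma mono0_poly (a : g) : polynomials (mono 0 a).
Proof. by exists 1%N => -[]. Qed.

(** A C[x]-linear map is fixed by its values on the constants [e_q], which become the rows of [M].
    Passing to matrices makes traces over C[x] available. *)
Lemma poly_linear_mx (F : (nat -> g) -> (nat -> g)) :
  (forall f, polynomials f -> polynomials (F f)) ->
  (forall p f h, polynomials f -> polynomials h ->
     F (poly_scale p f + h) = poly_scale p (F f) + F h) ->
  exists M, forall v, F (curve v) = curve (v *m M).
Proof.
move=> Fpoly Flin.
have /choice[r rE] q : exists w, F (mono 0 e`_q) = curve w.
  exact/curve_surj/Fpoly/mono0_poly.
(* Linearity with p = 1 gives F 0 = F 0 + F 0, which is cancelled among row vectors. *)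
have F0 : F 0 = 0.
  have /curve_surj[w wE] : polynomials (F 0) by rewrite -curve0; apply/Fpoly/curve_poly.
  have := Flin 1 _ _ (curve_poly 0) (curve_poly 0).
  rewrite -curve_scale scale1r addr0 curve0 wE -curve_scale scale1r => /curve_inj/esym/eqP.
  by rewrite -[X in _ == X]addr0 (inj_eq (addrI _)) => /eqP->; exact: curve0.
exists (\matrix_q r q) => v.
rewrite [in LHS](row_sum_delta v) mulmx_sum_row.
elim: (index_enum _) => [|q s IH]; first by rewrite !big_nil curve0.
rewrite !big_cons !curve_scale Flin ?curve_delta ?rE ?IH ?rowK //; last exact: curve_poly.
exact: mono0_poly.
Qed.

Lemma poly_scaleX (f : nat -> g) n :
  poly_scale 'X f n = if n is n'.+1 then f n' else 0.
Proof.
rewrite /poly_scale /fps_conv big_ord_recl coefX scale0r add0r.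
case: n => [|n]; rewrite ?big_ord0 // big_ord_recl coefX scale1r big1 ?addr0.
  by rewrite subSS subn0.
by move=> i _; rewrite coefX scale0r.
Qed.

End PolynomialModule.

(** * Automorphisms of g[x] over C[x] *)

Section Automorphism.
Variables (R : realType) (g : vectType R[i]) (br : g -> g -> g).
Hypothesis brP : lie_bracket_on [set: g] br.

Local Notation C := R[i].
Local Notation dim := (\dim {:g}).
Local Notation e := (vbasis {:g}).
Local Notation K := (killing br).

Lemma fps_br_poly (f h : nat -> g) :
  polynomials f -> polynomials h -> polynomials (fps_br br f h).
Proof.
move=> [N fN] [M hM]; exists (N + M)%N => n le_n; apply: big1 => -[i /= _] _.
have [/fN -> | lt_iN] := leqP N i.
  by rewrite (br0l brP).
by rewrite hM ?(br0 brP) // leq_subRL; lia.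
Qed.

(** Makes ad z a C[x]-linear map in the sense of [poly_linear_mx]; the two sides sum over one
    triangle in different orders. *)
Lemma fps_br_scale (z : nat -> g) p f h :
  fps_br br z (poly_scale p f + h) = poly_scale p (fps_br br z f) + fps_br br z h.
Proof.
apply/funext => n; rewrite /fps_br /poly_scale /fps_conv addrfctE.
under eq_bigr do rewrite (brD brP) (br_sum brP).
rewrite big_split /=; congr (_ + _).
pose G i j := p`_j *: br (z i) (f (n - i - j)%N).
transitivity (\sum_(i < n.+1) \sum_(j < n.+1 - i) G i j).
  apply: eq_bigr => -[i /= lt_in] _; rewrite -subSn //.
  by apply: eq_bigr => j _; rewrite (brZ brP).
rewrite exchange_triangle; apply: eq_bigr => -[j /= lt_jn] _.
rewrite scaler_sumr -subSn //; apply: eq_bigr => i _.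
by rewrite /G subnAC.
Qed.

Lemma fps_br_mono0l y f n : fps_br br (mono 0 y) f n = br y (f n).
Proof.
rewrite /fps_br /fps_conv big_ord_recl big1 ?addr0 ?subn0 // => i _.
by rewrite (br0l brP).
Qed.

Lemma fps_br_mono0r y f n : fps_br br f (mono 0 y) n = br (f n) y.
Proof.
rewrite /fps_br /fps_conv big_ord_recr big1 /= ?add0r ?subnn // => -[i /= lt_in] _.
by rewrite /mono subn_eq0 leqNgt lt_in (br0 brP).
Qed.

Variable sigma : (nat -> g) -> (nat -> g).
Hypothesis sigmaP : poly_automorphism br sigma.

Lemma aut_poly f : polynomials f -> polynomials (sigma f).
Proof. by case: (aut_bij sigmaP) => + _ _; apply. Qed.

(** Write f as x f' + f(0), pull x out of sigma and apply induction to f'. The same formula defines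
    [aut_fls], so the two actions can be compared. *)
Lemma aut_coef f i : polynomials f ->
  sigma f i = \sum_(k < i.+1) sigma (mono 0 (f (i - k)%N)) k.
Proof.
elim: i f => [|i IH] f [N fN].
all: have pf' : polynomials (fun n => f n.+1) by exists N => n ?; apply: fN; lia.
all: have {1}-> : f = poly_scale 'X (fun n => f n.+1) + mono 0 (f 0%N).
1,3: apply/funext => -[|n]; rewrite addrfctE poly_scaleX /mono /= ?add0r ?addr0 //.
all: rewrite (aut_linear sigmaP) // ?addrfctE ?poly_scaleX; try exact: mono0_poly.
  by rewrite add0r big_ord1.
rewrite big_ord_recr /= subnn IH //; congr (_ + _); apply: eq_bigr => k _.
by rewrite subSn // -ltnS.
Qed.

Lemma aut0 : sigma 0 = 0.
Proof.
have [S SE] := poly_linear_mx aut_poly (aut_linear sigmaP).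
by rewrite -(curve0 g) SE mul0mx.
Qed.

Lemma autZ p f : polynomials f -> sigma (poly_scale p f) = poly_scale p (sigma f).
Proof.
have [S SE] := poly_linear_mx aut_poly (aut_linear sigmaP).
by move=> /curve_surj[v ->]; rewrite -curveZ !SE -scalemxAl curveZ.
Qed.

(* The Killing form over C[x] is a trace, hence invariant under conjugation by
   the C[x]-linear map sigma. *)
Lemma killing_aut a x y s : polynomials a -> sigma a = mono 0 x ->
  K x (sigma (mono 0 y) s) = K (a s) y.
Proof.
move=> pa sa; set z := sigma (mono 0 y).
have pz : polynomials z by apply/aut_poly/mono0_poly.
have [S SE] := poly_linear_mx aut_poly (aut_linear sigmaP).
have [M1 M1E] := @poly_linear_mx _ _ (fun f => fps_br br a (fps_br br (mono 0 y) f))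
  (fun f pf => fps_br_poly pa (fps_br_poly (mono0_poly y) pf))
  (fun p f h _ _ => etrans (congr1 _ (fps_br_scale _ p f h)) (fps_br_scale _ _ _ _)).
have [M2 M2E] := @poly_linear_mx _ _ (fun f => fps_br br (mono 0 x) (fps_br br z f))
  (fun f pf => fps_br_poly (mono0_poly x) (fps_br_poly pz pf))
  (fun p f h _ _ => etrans (congr1 _ (fps_br_scale _ p f h)) (fps_br_scale _ _ _ _)).
(* [T] is the matrix of the inverse of sigma: its rows are the preimages of the constants [e_q]. *)
have [T TS] : exists T, T *m S = 1%:M.
  have /choice[r rE] q : exists w, sigma (curve w) = mono 0 e`_q.
    have [_ _ /(_ _ (mono0_poly e`_q))[f pf <-]] := aut_bij sigmaP.
    by have [w ->] := curve_surj pf; exists w.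
  exists (\matrix_q r q); apply/row_matrixP => q.
  by rewrite row_mul rowK row1; apply: (@curve_inj _ g); rewrite -SE rE curve_delta.
(* [M1] and [M2] represent (ad a)(ad y) and (ad x)(ad z); sigma intertwines them, as it sends a to x
   and y to z. *)
have SM : S *m M2 = M1 *m S.
  apply/row_matrixP => q; rewrite !rowE !mulmxA; apply: (@curve_inj _ g).
  have pq := @curve_poly _ g (delta_mx 0 q); have py := mono0_poly y.
  by rewrite -M2E -SE -SE -M1E -sa -!(aut_br sigmaP) //; apply: fps_br_poly.
have trM : \tr M2 = \tr M1.
  by rewrite -[M2]mul1mx -TS -mulmxA SM mulmxA mxtrace_mulC mulmxA (mulmx1C TS) mul1mx.
have dE (M : 'M[{poly C}]_dim) q : (M q q)`_s = coord e q (curve (delta_mx 0 q *m M) s) :> C.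
  by rewrite coord_curve -rowE mxE.
transitivity ((\tr M2)`_s).
  rewrite /mxtrace coef_sum; apply: eq_bigr => q _.
  by rewrite dE -M2E curve_delta fps_br_mono0l fps_br_mono0r.
rewrite trM /mxtrace coef_sum; apply: eq_bigr => q _; rewrite dE -M1E curve_delta.
rewrite [fps_br br (mono 0 y) _](_ : _ = mono 0 (br y e`_q)) ?fps_br_mono0r //.
by apply/funext => n; rewrite fps_br_mono0l /mono; case: eqP => // _; rewrite (br0 brP).
Qed.

End Automorphism.

(** * Weights, and the coefficients of elements of O_h *)

Section Weights.
Variables (R : realType) (g : vectType R[i]) (br : g -> g -> g).
Hypothesis brP : lie_bracket_on [set: g] br.
Variable H : {vspace g}.

Local Notation C := R[i].
Local Notation K := (killing br).
Local Notation dual := 'Hom(subvs_of H, C^o).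
Local Notation isroot := (@Defs.roots R g br H).
Local Notation weight := (@root_space R g br H).

Lemma dual_neq (a b : dual) : a != b -> exists h, a h != b h.
Proof.
move=> ab; apply: contrapT => /forallNP ab'; case/eqP: ab; apply/lfunP => h.
by apply/eqP; have /negP := ab' h; rewrite negbK.
Qed.

(** For [h] with (a + b)(h) nonzero, invariance of K gives (a + b)(h) K(x, y) = 0. *)
Lemma killing_weight a b x y : weight a x -> weight b y -> a + b != 0 -> K x y = 0.
Proof.
move=> wx wy /dual_neq[h]; rewrite (_ : (a + b) h = a h + b h); last exact: lfunE.
rewrite (_ : (0 : dual) h = 0); last exact: lfunE.
move=> abh.
have := killing_inv brP x (vsval h) y; rewrite (brC brP) wx wy.
rewrite -scaleN1r !(killingZl brP) (killingZr brP) mulN1r => /eqP.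
by rewrite eq_sym -subr_eq0 opprK -mulrDl addrC mulf_eq0 (negPf abh) => /eqP.
Qed.

(** Induction on the number of summands: if [h] separates a from the weight b of the first one, ad h
    - b(h) kills that summand, rescales the others, and multiplies v by the nonzero a(h) - b(h). *)
Lemma weight_indep a v (s : seq (dual * g)) :
  weight a v -> (forall bx, bx \in s -> bx.1 != a /\ weight bx.1 bx.2) ->
  v = \sum_(bx <- s) bx.2 -> v = 0.
Proof.
have [n] := ubnP (size s); elim: n s v => // n IH [|[b x] s] v.
  by rewrite big_nil.
rewrite ltnS => szs wv ws.
rewrite big_cons /= => vE.
have [ba wx] := ws _ (mem_head _ _); have [h bah] := dual_neq ba.
have ws' cy : cy \in s -> cy.1 != a /\ weight cy.1 cy.2.
  by move=> cys; apply: ws; rewrite inE cys orbT.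
pose s' := [seq (cy.1, (cy.1 h - b h : C) *: cy.2) | cy : dual * g <- s].
have wZ c k y : weight c y -> weight c (k *: y).
  by move=> wy h'; rewrite (brZ brP) wy !scalerA mulrC.
suff /eqP : (a h - b h : C) *: v = 0.
  by rewrite scaler_eq0 subr_eq0 eq_sym (negPf bah) => /eqP.
apply: (IH s'); [by rewrite size_map | exact: wZ | |].
  move=> _ /mapP[cy cys ->] /=; have [ca wy] := ws' _ cys.
  by split=> //; apply: wZ.
rewrite big_map scalerBl -wv {1}vE (brD brP) wx (br_sum brP) vE scalerDr /=.
rewrite opprD addrACA subrr add0r scaler_sumr -sumrB.
apply: eq_big_seq => cy cys /=; have [_ wy] := ws' _ cys.
by rewrite wy scalerBl.
Qed.

Lemma lfun_basis_sep (X : seq dual) z :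
  basis_of fullv X -> (forall a, a \in X -> a z = 0) -> z = 0.
Proof.
move=> bX Xz.
have Lz (L : dual) : L z = 0.
  rewrite (coord_basis (X := in_tuple X) bX (memvf L)) sum_lfunE big1 // => p _.
  by rewrite scale_lfunE Xz ?scaler0 // mem_nth.
rewrite (coord_vbasis (memvf z)); apply: big1 => p _.
have := Lz (linfun (coord (vbasis fullv) p : subvs_of H -> C^o)).
by rewrite lfunE /= => ->; rewrite scale0r.
Qed.

Hypothesis Hcartan : cartan br H.

Lemma cartan_br x y : x \in H -> y \in H -> br x y \in H.
Proof.
have [brH _ _] := Hcartan => xH yH; apply: (subvP brH).
rewrite (coord_vbasis yH) (br_sum brP) memv_suml // => q _.
rewrite (brZ brP) memvZ // (brC brP) memvN (coord_vbasis xH) (br_sum brP).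
rewrite memv_suml // => p _; rewrite (brZ brP) memvZ // (brC brP) memvN.
by rewrite memv_span //; apply: allpairs_f; rewrite mem_nth // size_tuple.
Qed.

Variables (alpha : 'I_(\dim H).+1 -> dual) (k : 'I_(\dim H).+1 -> nat).
Hypothesis Hbase : extended_base br alpha k.

(* [H, H] is killed by all the roots, and these span the dual of H. *)
Lemma cartan_weight0 x : x \in H -> weight 0 x.
Proof.
move=> xH h; rewrite zero_lfunE scale0r.
pose z := Subvs (cartan_br (valP h) xH).
suff /(congr1 vsval) : z = 0 by [].
apply: lfun_basis_sep (base_basis Hbase) _ => _ /mapP[j _ ->].
have [_ [y y0 wy]] := base_roots Hbase j.
have /eqP := wy z; rewrite /z /= (br_jacobi brP) wy (wy (Subvs xH)).
rewrite !(brZ brP) wy (wy (Subvs xH)) !scalerA mulrC subrr eq_sym scaler_eq0.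
by rewrite (negPf y0) orbF => /eqP.
Qed.

Lemma root_neq0 a : isroot a -> a != 0.
Proof. by case. Qed.

Lemma order_atE h (F : int -> g) n : order_at br h F ->
  exists (x : g) (s : seq dual) (f : dual -> int -> C) (u : dual -> g),
    [/\ weight 0 x, (0 < n -> x = 0),
        (forall a, a \in s -> [/\ isroot a, val_ge (a h) (f a) & weight a (u a)])
      & F n = x + \sum_(a <- s) f a n *: u a].
Proof.
move=> [F0 [f [u [[F0inv F0H] fu ->]]]].
case: (finite_supportP (isroot) (fun a : dual => (fun n : int => f a n *: u a)) 0).
  (* A family with infinitely many nonzero terms has sum 0 by convention; the empty list covers this
     case. *)
  move=> _; exists (F0 n), [::], f, u; split=> //; [exact: cartan_weight0 | exact: F0inv |].
  by rewrite addrfctE !big_nil.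
move=> X Xroots _ _; exists (F0 n), (finmap.enum_fset X), f, u; split.
- exact: cartan_weight0.
- exact: F0inv.
- by move=> a aX; have ra := Xroots _ aX; have [] := fu _ ra.
by rewrite addrfctE fct_sumE.
Qed.

Lemma val_geP (r : C) (f : int -> C) n : val_ge r f -> f n != 0 -> r <= (- n)%:~R.
Proof.
move=> [[N fN] fr] fn.
(* [M] is the top exponent of f, so [- M] is the valuation. The climb from n stops because f
   vanishes above [N]. *)
have [M [nM fM fM']] : exists M, [/\ n <= M, f M != 0 & forall m, M < m -> f m = 0].
  have [p] := ubnP `|N - n|%N; elim: p n fn => [|p IH] n fn; [by rewrite ltn0 | rewrite ltnS => Np].
  have [[n' [nn' fn']]|noM] := pselect (exists n', n < n' /\ f n' != 0); last first.
    exists n; split=> // m nm; apply/eqP; apply: contrapT => /negP fm.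
    by apply: noM; exists m.
  have n'N : n' <= N by rewrite leNgt; apply: contra fn' => /fN ->.
  have [|M [n'M fM fM']] := IH n' fn'; first lia.
  by exists M; split=> //; rewrite (le_trans _ n'M) // ltW.
apply: (le_trans (fr (- M) _)); last by rewrite ler_int lerN2.
by split=> [|m mM]; rewrite ?opprK // fM' // ltrNr.
Qed.

(** K(x, -) sees only the component of weight -a, whose exponents n satisfy -n >= -a(h). *)
Lemma order_at_killing h F n a x :
  order_at br h F -> isroot a -> weight a x -> K x (F n) != 0 -> n%:~R <= (a h : C).
Proof.
move=> /(order_atE n)[y [s [f [u [wy _ sP ->]]]]] ra wx.
rewrite (killingDr brP) (killing_weight wx wy) ?addr0 ?root_neq0 // add0r.
rewrite (killing_sumr brP) => nz.
have [b bs fb] : exists2 b : dual, b \in s & K x (f b n *: u b) != 0.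
  apply: contrapT => no; case/eqP: nz; apply: big1_seq => b /andP[_ bs].
  by apply/eqP; apply: contrapT => /negP fb; apply: no; exists b.
have [_ vb wb] := sP _ bs; move: fb.
rewrite (killingZr brP) mulf_eq0 negb_or => /andP[fb].
have [/eqP|ab] := eqVneq (a + b) 0; last by rewrite (killing_weight wx wb ab) eqxx.
rewrite addr_eq0 => /eqP -> _; have := val_geP vb fb.
rewrite (_ : (- b) h = - b h); last exact: lfunE.
by rewrite lerNr -intrN.
Qed.

(** By independence of weights, the term of weight a must contribute to [F n], so -n >= a(h). *)
Lemma order_at_weight h F n a :
  order_at br h F -> isroot a -> weight a (F n) -> F n != 0 -> n%:~R <= - (a h : C).
Proof.
move=> /(order_atE n)[y [s [f [u [wy _ sP FE]]]]] ra wF Fn0.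
have [[as_ fa]|no] := pselect (a \in s /\ f a n != 0).
  by have [_ va _] := sP _ as_; have := val_geP va fa; rewrite intrN lerNr.
(* Here the term of weight a is absent at x^n, which leaves [F n] as a sum of the Cartan part, of
   weight 0, and of vectors of other root weights. *)
case/eqP: Fn0; pose s' := [seq (b, f b n *: u b) | b <- s & b != a].
apply: (@weight_indep a _ ((0, y) :: s')) => //.
  move=> _ /[!inE]/orP[/eqP -> |/mapP[b + ->]]; first by rewrite eq_sym root_neq0.
  rewrite mem_filter => /andP[ba bs]; split=> //= h'; have [_ _ wb] := sP _ bs.
  by rewrite (brZ brP) wb !scalerA mulrC.
rewrite big_cons big_map big_filter /= FE; congr (_ + _); rewrite [RHS]big_mkcond.
apply: eq_big_seq => b bs; case: eqP => //= ba; rewrite -ba in no.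
have [->|fb] := eqVneq (f b n) 0; first by rewrite scale0r.
by case: no.
Qed.

End Weights.

(** * Finitely supported sums as sums over ranges *)

Lemma fsbig_iota (V : nmodType) (F : nat -> V) (L : nat) :
  (forall i, (L <= i)%N -> F i = 0) -> \sum_(i \in [set: nat]) F i = \sum_(i < L) F i.
Proof.
move=> FL; rewrite (fsbigE (iota 0 L)) ?iota_uniq //; last first.
  by move=> i _; rewrite mem_iota add0n -leqNgt => /FL.
rewrite -[RHS](big_mkord xpredT F) /index_iota subn0.
by apply: eq_bigl => i; rewrite in_setT.
Qed.

Lemma fsbig_int (V : nmodType) (F : int -> V) (A : int) (L : nat) :
  (forall i, i < A -> F i = 0) -> (forall i, A + L%:Z <= i -> F i = 0) ->
  \sum_(i \in [set: int]) F i = \sum_(i < L) F (A + i%:Z).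
Proof.
move=> FA FL; rewrite (fsbigE [seq A + i%:Z | i <- iota 0 L]) //.
- rewrite big_map -[RHS](big_mkord xpredT (fun i => F (A + i%:Z))) /index_iota subn0.
  by apply: eq_bigl => i; rewrite in_setT.
- by rewrite map_inj_uniq ?iota_uniq // => i j /addrI[].
move=> i _ iA; have [/FA //|Ai] := ltP i A; apply: FL; rewrite leNgt.
apply: contra iA => iL; apply/mapP; exists `|i - A|%N; last by lia.
by rewrite mem_iota; lia.
Qed.

(** * The Killing form of g((x)) *)

Section LaurentKilling.
Variables (R : realType) (g : vectType R[i]) (br : g -> g -> g).
Hypothesis brP : lie_bracket_on [set: g] br.

Local Notation C := R[i].
Local Notation dim := (\dim {:g}).
Local Notation e := (vbasis {:g}).
Local Notation K := (killing br).

(** The constants [e_p] form a basis, so the trace over C((x)) is K extended bilinearly. The last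
    hypothesis makes the terms of index at least [L] fall below the support of [f2]. *)
Lemma killing_laurentE (f1 f2 : int -> g) (A B n : int) (L : nat) :
  (forall n, n < A -> f1 n = 0) -> (forall n, n < B -> f2 n = 0) ->
  n - A - L%:Z < B ->
  killing_laurent br f1 f2 n = \sum_(i < L) K (f1 (A + i%:Z)) (f2 (n - A - i%:Z)).
Proof.
move=> f1A f2B nL.
have cE (y : g) m : fls_br br f2 (fps_to_fls (mono 0 y)) m = br (f2 m) y.
  rewrite /fls_br /fls_conv (@fsbig_int _ _ m 1) ?big_ord1 ?addr0 ?subrr // => i im.
    have : m - i != 0 by rewrite subr_eq0; lia.
    by case: (m - i) => [[|p]|p] //= _; rewrite (br0 brP).
  by have -> : m - i = Negz `|i - m|.-1; [lia | rewrite (br0 brP)].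
rewrite /killing /killing_laurent exchange_big; apply: eq_bigr => p _ /=.
rewrite {1}/fls_br /fls_conv (@fsbig_int _ _ A L).
- rewrite linear_sum; apply: eq_bigr => i _ /=; rewrite cE; do 4?f_equal; lia.
- by move=> i /f1A ->; rewrite (br0l brP).
by move=> i Ai; rewrite cE f2B ?(br0l brP) ?(br0 brP) //; lia.
Qed.

Lemma killing_laurent_low (f1 f2 : int -> g) (A B n : int) :
  (forall n, n < A -> f1 n = 0) -> (forall n, n < B -> f2 n = 0) ->
  n - A < B -> killing_laurent br f1 f2 n = 0.
Proof.
by move=> f1A f2B nAB; rewrite (@killing_laurentE _ _ A B n 0) ?big_ord0 ?subr0.
Qed.

End LaurentKilling.

(** * The functional t as a constant term *)

Section Residue.
Variables (R : realType) (t : (int -> R[i]) -> R[i]) (b : nat -> R[i]).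

Local Notation C := R[i].

Hypothesis t_linear :
  linear_on (V := int -> R[i]^o) (U := R[i]^o) (laurent (V := R[i]^o)) t.
Hypothesis t_neg : forall k : nat, (1 <= k)%N -> t (xpow R (- k%:Z)) = b k.
Hypothesis b0 : b 0%N = 1.
Hypothesis t_fps : forall s : nat -> C, t (fps_to_fls (V := C^o) s) = s 0%N.

(** Linearity strips off the negative powers, the lowest first, each evaluated by [t_neg]. What
    remains is a power series, an infinite sum beyond the reach of linearity, hence the hypothesis
    [t_fps]. The result is the constant term of b(x) G(x). *)
Lemma laurent_functionalE (G : int -> C) (L : nat) :
  (forall n, n <= - L.+1%:Z -> G n = 0) ->
  t G = \sum_(q < L.+1) b q * G (- q%:Z).
Proof.
elim: L G => [|L IH] G GL.
  rewrite big_ord1 b0 mul1r oppr0 -(t_fps (fun n => G n%:Z)); congr t.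
  by apply/funext => -[n|n] //=; rewrite GL // NegzE; lia.
pose G' : int -> C := fun n => if n == - L.+1%:Z then 0 else G n.
have GE : G = (G (- L.+1%:Z) : C) *: (xpow R (- L.+1%:Z) : int -> C^o) + G'.
  apply/funext => n; transitivity (G (- L.+1%:Z) * (n == - L.+1%:Z)%:R + G' n) => //.
  by rewrite /G'; case: eqP => [->|_]; rewrite ?mulr1 ?addr0 // mulr0 add0r.
have G'L n : n <= - L.+1%:Z -> G' n = 0.
  by rewrite /G' le_eqVlt; case: eqP => //= _ ?; apply: GL; lia.
rewrite {1}GE t_linear; last 2 first.
- by exists (- L.+1%:Z) => n ?; rewrite /xpow; case: eqP => //; lia.
- by exists (- L.+1%:Z) => n nL; apply: G'L; exact: ltW.
rewrite (IH G') // [in RHS]big_ord_recr /= t_neg // [RHS]addrC.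
rewrite [b L.+1 * _]mulrC; congr (_ + _); apply: eq_bigr => q _.
by rewrite /G'; case: eqP => // ?; have := ltn_ord q; lia.
Qed.

End Residue.

(** * The form on the double and the maximality of W *)

Section Double.
Variables (R : realType) (g : vectType R[i]) (br : g -> g -> g).
Hypothesis g_simple : simple_lie br.

Local Notation C := R[i].
Local Notation dim := (\dim {:g}).
Local Notation e := (vbasis {:g}).
Local Notation K := (killing br).

Let brP : lie_bracket_on [set: g] br. Proof. by case: g_simple. Qed.

Variables (t : (int -> C) -> C) (b : nat -> C).
Hypothesis t_linear :
  linear_on (V := int -> R[i]^o) (U := R[i]^o) (laurent (V := R[i]^o)) t.
Hypothesis t_neg : forall k : nat, (1 <= k)%N -> t (xpow R (- k%:Z)) = b k.
Hypothesis b0 : b 0%N = 1.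

Variables (brD : double_type g -> double_type g -> double_type g)
  (Phi : double_type g -> (int -> g) * g).
Hypothesis PhiP : double_iso br t brD Phi.

Lemma distributions0 : distributions (0 : (nat -> g) -> C^o).
Proof.
split; last by exists 0%N.
by move=> a f h; rewrite mulr0 addr0.
Qed.

Lemma distributions_coord p n : distributions (fun f : nat -> g => coord e p (f n) : C^o).
Proof.
split; first by move=> a f h; rewrite linearP.
by exists n.+1 => f -> //; rewrite linear0.
Qed.

Lemma double_target u : Defs.double u -> target (Phi u).
Proof. by case: (iso_bij PhiP) => + _ _; apply. Qed.

Lemma t_zero : t 0 = 0.
Proof.
have l0 : laurent (0 : int -> C^o) by exists 0.
have := t_linear (-1) l0 l0; rewrite scaleN1r oppr0 addr0 => ->.
by rewrite scaleN1r addNr.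
Qed.

(** If K vanished, so would K' and the whole form on the target; but in the double a nonzero
    constant series pairs nontrivially with some coordinate functional. *)
Lemma killing_nonzero : exists x y, K x y != 0.
Proof.
apply: contrapT => no.
have K0 x y : K x y = 0 by apply/eqP; apply: contrapT => /negP xy; apply: no; exists x, y.
have [_ [x [y xy]] _] := g_simple.
have [p xp] : exists p, coord e p (br x y) != 0.
  apply: contrapT => np; case/eqP: xy; apply: coords_inj; apply/rowP => p.
  by rewrite !mxE linear0; apply/eqP; apply: contrapT => /negP xp; apply: np; exists p.
pose u : double_type g := (mono 0 (br x y), 0).
pose v : double_type g := (0, fun f => coord e p (f 0%N)).
have du : Defs.double u by exact: distributions0.
have dv : Defs.double v by exact: distributions_coord.
have [c c0 /(_ u v du dv)] := iso_form PhiP.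
have [A uA] := double_target du; have [B vB] := double_target dv.
rewrite /target_form K0 subr0 (_ : killing_laurent _ _ _ = 0).
  rewrite t_zero /double_form /= => /esym/eqP; rewrite mulf_eq0 (negPf c0) /=.
  by rewrite addr0 (negPf xp).
apply/funext => n; rewrite (@killing_laurentE _ _ _ brP _ _ A B n (`|(n - A - B)%R|%N).+1) //.
  by apply: big1 => i _; rewrite K0.
by lia.
Qed.

(* g[[x]] is isotropic, so t (K' (s a, y)) = K (s(0) a, y). *)
Lemma t_fps (s : nat -> C) : t (fps_to_fls (V := C^o) s) = s 0%N.
Proof.
have [x [y xy]] := killing_nonzero.
pose u : double_type g := (fun n => s n *: x, 0).
pose v : double_type g := (mono 0 y, 0).
have du : Defs.double u by exact: distributions0.
have dv : Defs.double v by exact: distributions0.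
have [c c0 /(_ u v du dv)] := iso_form PhiP.
rewrite /double_form addr0 mulr0 !(iso_embed PhiP) /target_form /= => /eqP.
rewrite (killingZl brP) subr_eq0.
have low (f : nat -> g) n : n < 0 -> fps_to_fls f n = 0 by case: n.
have -> : killing_laurent br (fps_to_fls (fun n => s n *: x)) (fps_to_fls (mono 0 y)) =
    (K x y : C) *: (fps_to_fls (V := C^o) s : int -> C^o) + 0.
  rewrite addr0; apply/funext => n; transitivity (K x y * fps_to_fls (V := C^o) s n) => //.
  case: n => n; last first.
    by rewrite (killing_laurent_low brP (low _) (low _)) //= mulr0.
  rewrite (@killing_laurentE _ _ _ brP _ _ 0 0 n n.+1) //; try exact: low; last by lia.
  rewrite big_ord_recr /= big1 => [|i _].
    by rewrite subr0 subrr !add0r /= (killingZl brP) mulrC.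
  have ->: n%:Z - 0 - i%:Z = (n - i)%N%:Z by have := ltn_ord i; lia.
  rewrite /= /mono; case: eqP => [|_]; first by have := ltn_ord i; lia.
  by rewrite (killing0r brP).
rewrite t_linear; last 2 first.
- by exists 0 => -[].
- by exists 0.
by rewrite t_zero addr0 mulrC => /eqP/(mulfI xy).
Qed.

(** Write u as the image of (f, phi). Orthogonality to the images of the coordinate distributions
    says that every coefficient of f vanishes. *)
Lemma manin_maximal u : target u ->
  (forall w, manin_complement Phi w -> target_form br t u w = 0) ->
  manin_complement Phi u.
Proof.
have [_ _ Phi_surj] := iso_bij PhiP; move=> /Phi_surj[[f phi] dphi <-] perp.
have [c c0 formE] := iso_form PhiP.
suff -> : f = 0 by exists phi.
apply/funext => n; apply: coords_inj; apply/rowP => p; rewrite !mxE linear0.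
have dpsi := distributions_coord p n.
have /eqP := perp _ (ex_intro2 _ _ _ dpsi erefl).
rewrite formE // mulf_eq0 (negPf c0) /double_form /=.
have [phi_lin _] := dphi.
have -> : phi 0 = 0.
  by have := phi_lin (-1) 0 0; rewrite scaleN1r oppr0 addr0 mulN1r addNr.
by rewrite addr0 => /eqP.
Qed.

Lemma target_complement w : manin_complement Phi w -> target w.
Proof. by move=> [phi dphi <-]; apply: double_target. Qed.

(** * The series x^(m-1) a / b and its membership in W *)

Variables (H : {vspace g}) (Hcartan : cartan br H).
Variables (alpha : 'I_(\dim H).+1 -> 'Hom(subvs_of H, C^o))
  (k : 'I_(\dim H).+1 -> nat).
Hypothesis Hbase : extended_base br alpha k.
Variables (sigma : (nat -> g) -> (nat -> g)) (h : subvs_of H).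
Hypothesis sigmaP : poly_automorphism br sigma.
Hypothesis W_order :
  [set aut_act sigma u | u in ring_span (manin_complement Phi)]
    `<=` order_at br h `*` [set: g].

(** The unit (1, 1) of the ring puts w itself into the span; [xpow R 0] is the series 1. *)
Lemma complement_order w : manin_complement Phi w -> order_at br h (aut_fls sigma w.1).
Proof.
move=> Ww; suff /W_order[] :
  [set aut_act sigma u | u in ring_span (manin_complement Phi)] (aut_act sigma w) by [].
exists w => //.
exists 1%N, (fun=> 1), (fun=> w); split; last by rewrite big_ord1 scale1r.
move=> _; exists w, (xpow R 0), 1; split=> //.
  by move=> n n0; rewrite /xpow; case: eqP => // nE; rewrite nE ltxx in n0.
rewrite scale1r [LHS]surjective_pairing; congr (_, _); apply/funext => n.
rewrite /fls_conv (@fsbig_int _ _ 0 1) ?big_ord1 /xpow ?addr0 ?eqxx ?scale1r ?subr0 // => i i0.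
  by case: eqP => [ie|_]; [rewrite ie ltxx in i0 | rewrite scale0r].
by case: eqP => [ie|_]; [rewrite ie in i0 | rewrite scale0r].
Qed.

(** Here f is bounded below and may have infinitely many positive powers; the sum is finite because
    [n - i] falls below [B]. So sigma applies to x^(m-1) a / b as it stands. *)
Lemma aut_flsE (f : int -> g) (B n : int) (L : nat) :
  (forall n, n < B -> f n = 0) -> n - L%:Z < B ->
  aut_fls sigma f n = \sum_(i < L) sigma (mono 0 (f (n - i%:Z))) i.
Proof.
move=> fB nL; apply: fsbig_iota => i Li; rewrite fB; last by lia.
have -> : mono 0 0 = 0 :> (nat -> g) by apply/funext => m; rewrite /mono; case: eqP.
by rewrite (aut0 sigmaP).
Qed.

Variable c : nat -> C.
Hypothesis bc : fps_mul b c = @fps_one C.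

(* c is 1/b, so this is the series x^(m-1) a / b. *)
Definition twisted_loop (m : int) (a : nat -> g) : int -> g := fun n =>
  if n - (m - 1) is Posz j then fps_conv (U := C^o) (V := g) (W := g) *:%R c a j else 0.

Lemma twisted_loop_low m a n : n < m - 1 -> twisted_loop m a n = 0.
Proof. by rewrite /twisted_loop -subr_lt0; case: (n - _). Qed.

Lemma twisted_loopE m a i : twisted_loop m a (m - 1 + i%:Z) = \sum_(j < i.+1) c j *: a (i - j)%N.
Proof. by rewrite /twisted_loop addrAC subrr add0r. Qed.

Section RootVector.
Variables (m : int) (a : nat -> g) (x : g).
Hypothesis pa : polynomials a.
Hypothesis sa : sigma a = mono 0 x.
Local Notation u := (twisted_loop m a).

Lemma aut_twisted_loop i : aut_fls sigma u (m - 1 + i%:Z) = c i *: x.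
Proof.
rewrite (@aut_flsE _ (m - 1) _ i.+1); [|exact: twisted_loop_low|by lia].
(* The coefficient in question involves only c_0, ..., c_i, so 1/b may be truncated to a polynomial,
   to which C[x]-linearity of sigma applies. *)
pose p := \poly_(j < i.+1) c j.
transitivity (sigma (poly_scale p a) i).
  have ppa : polynomials (poly_scale p a).
    by have [v ->] := curve_surj pa; rewrite -curveZ; apply: curve_poly.
  rewrite (aut_coef sigmaP) //; apply: eq_bigr => -[j /= ji] _; congr (sigma (mono 0 _) _).
  have -> : m - 1 + i%:Z - j%:Z = m - 1 + (i - j)%N%:Z by lia.
  rewrite twisted_loopE; apply: eq_bigr => -[l /= li] _; rewrite coef_poly ifT //; lia.
rewrite (autZ sigmaP) // sa /poly_scale /fps_conv big_ord_recr big1 => [|[j /= ji] _].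
  by rewrite /= add0r subnn /mono eqxx coef_poly ltnSn.
by rewrite /mono subn_eq0 leqNgt ji scaler0.
Qed.

(** [killing_aut] moves sigma across K in each term; the sum is the coefficient of x^n in K'(a,
    w). *)
Lemma killing_aut_fls (w : int -> g) (B n : int) (L : nat) :
  (forall n, n < B -> w n = 0) -> n - L%:Z < B ->
  K x (aut_fls sigma w n) = \sum_(i < L) K (a i) (w (n - i%:Z)).
Proof.
move=> wB nL; rewrite (aut_flsE wB nL) (killing_sumr brP).
by apply: eq_bigr => i _; rewrite (killing_aut brP sigmaP _ _ pa sa).
Qed.

(** The scalar series x^(m-1) c(x) comes out of K', and [killing_aut_fls] identifies the remaining
    factor. *)
Lemma killing_twisted_loop (w : int -> g) (B n : int) (L : nat) :
  (forall n, n < B -> w n = 0) -> n - (m - 1) - L%:Z < B ->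
  killing_laurent br u w n =
  \sum_(j < L) c j * K x (aut_fls sigma w (n - (m - 1) - j%:Z)).
Proof.
move=> wB nL; rewrite (killing_laurentE brP (@twisted_loop_low m a) wB nL).
pose F j l := c j * K (a l) (w (n - (m - 1) - j%:Z - l%:Z)).
transitivity (\sum_(i < L) \sum_(j < i.+1) F j (i - j)%N).
  apply: eq_bigr => i _; rewrite twisted_loopE (killing_suml brP).
  apply: eq_bigr => -[j /= ji] _; rewrite (killingZl brP) /F; congr (_ * K _ (w _)); lia.
rewrite big_triangle; apply: eq_bigr => -[j /= jL] _.
by rewrite (@killing_aut_fls _ B _ (L - j)) ?mulr_sumr //; lia.
Qed.

(** The factor b produced by t cancels c = 1/b, which leaves the constant term of x^(m-1) K(x,
    sigma(w)). *)
Lemma t_twisted_loop (w : int -> g) (B : int) :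
  (forall n, n < B -> w n = 0) ->
  t (killing_laurent br u w) = K x (aut_fls sigma w (1 - m)).
Proof.
(* K'(u, w) has no exponent below m - 1 + B, hence none below [- L]. *)
move=> wB; pose L := `|(1 - m - B)%R|%N.
have [LB L0] : 1 - m - L.+1%:Z < B /\ 1 - m - L%:Z <= B by rewrite /L; lia.
pose P n := K x (aut_fls sigma w n).
have PB n : n < B -> P n = 0.
  by move=> nB; rewrite /P (@killing_aut_fls _ B n 0) ?big_ord0 // subr0.
rewrite (laurent_functionalE t_linear t_neg b0 t_fps (L := L)); last first.
  move=> n nL; apply: (killing_laurent_low brP (@twisted_loop_low m a) wB); lia.
pose F q j := b q * (c j * P (1 - m - q%:Z - j%:Z)).
transitivity (\sum_(q < L.+1) \sum_(j < L.+1 - q) F q j).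
  apply: eq_bigr => -[q /= qL] _; rewrite (@killing_twisted_loop _ B _ (L.+1 - q)) //; last by lia.
  rewrite mulr_sumr; apply: eq_bigr => j _; rewrite /F; congr (_ * (_ * P _)); lia.
(* On the antidiagonal q + j = s the coefficients add up to that of x^s in b c = 1, so only s = 0
   survives. *)
rewrite -big_triangle (eq_bigr (fun s : 'I_L.+1 => fps_mul b c s * P (1 - m - s%:Z))).
  rewrite bc big_ord_recl /fps_one eqxx mul1r subr0 big1 ?addr0 // => i _.
  by rewrite mul0r.
move=> [s /= sL] _; rewrite /fps_mul /fps_conv mulr_suml.
apply: eq_bigr => -[q /= qs] _; rewrite /F mulrA; congr (_ * P _); lia.
Qed.

End RootVector.

(** The hypothesis on m excludes 1 - m <= beta(h), so K(x, -) kills the coefficient of x^(1-m) in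
    sigma(w) for every w in W, and maximality puts the twisted loop in W. The coefficient c_i x of
    its image, of weight beta, then obeys the bound of O_h. *)
Lemma inverse_degree beta m i : Defs.roots br beta ->
  (forall n : int, n%:~R <= (beta h : C) -> n <= - m) ->
  c i != 0 -> (m - 1 + i%:Z)%:~R <= - (beta h : C).
Proof.
move=> rb bm ci; have [_ [x x0 wx]] := rb.
have [_ _ /(_ _ (mono0_poly x))[a pa sa]] := aut_bij sigmaP.
(* Taking 0 in the summand g leaves only the t-term of the form. *)
have Wu : manin_complement Phi (twisted_loop m a, 0).
  apply: manin_maximal; first by exists (m - 1) => n; apply: twisted_loop_low.
  move=> w Ww; have [B wB] := target_complement Ww.
  rewrite /target_form /= (killing0l brP) subr0 (t_twisted_loop m pa sa wB).
  apply/eqP; apply: contrapT => /negP nz.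
  have := order_at_killing brP Hcartan Hbase (complement_order Ww) rb wx nz.
  by move=> /bm; lia.
have FE := aut_twisted_loop m pa sa i.
apply: (order_at_weight brP Hcartan Hbase (complement_order Wu) rb); rewrite /= FE.
  by move=> h'; rewrite (brZ brP) wx !scalerA mulrC.
by rewrite scaler_eq0 negb_or ci.
Qed.

End Double.

(** * The degree of 1/b at each vertex *)

Theorem theorem4p16 (R : realType) (g : vectType R[i]) (br : g -> g -> g)
  (hg : simple_lie br)
  (delta : (nat -> g) -> (nat -> nat -> tens g))
  (hdelta : lie_bialgebra_poly br delta)
  (t : (int -> R[i]) -> R[i]) (b : nat -> R[i])
  (ht_linear : linear_on (V := int -> R[i]^o) (U := R[i]^o)
                 (laurent (V := R[i]^o)) t)
  (ht_pos : forall k : nat, (1 <= k)%N -> t (xpow R k%:Z) = 0)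
  (ht_one : t (xpow R 0) = 1)
  (ht_neg : forall k : nat, (1 <= k)%N -> t (xpow R (- k%:Z)) = b k)
  (hb0 : b 0%N = 1)
  (brD : double_type g -> double_type g -> double_type g)
  (hbrD : double_bracket br delta brD)
  (Phi : double_type g -> (int -> g) * g)
  (hPhi : double_iso br t brD Phi)
  (H : {vspace g}) (hH : cartan br H)
  (alpha : 'I_(\dim H).+1 -> 'Hom(subvs_of H, R[i]^o))
  (k : 'I_(\dim H).+1 -> nat)
  (hbase : extended_base br alpha k)
  (i : 'I_(\dim H).+1) (h : subvs_of H) (hh : vertex_point alpha k i h)
  (sigma : (nat -> g) -> (nat -> g)) (hsigma : poly_automorphism br sigma)
  (hW : [set aut_act sigma u | u in ring_span (manin_complement Phi)]
          `<=` order_at br h `*` [set: g]) :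
  (k i = 1%N ->
     exists2 p : {poly R[i]}, (size p <= 2)%N &
       fps_mul b (fun n => p`_n) = @fps_one R[i]) /\
  ((1 < k i)%N -> b = @fps_one R[i]).
Proof.
have [c bc] := fps_inverse hb0.
have deg (r : R[i]) beta (m : int) j : Defs.roots br beta -> beta h = r ->
    (forall n : int, n%:~R <= r -> n <= - m) -> c j != 0 -> (m - 1 + j%:Z)%:~R <= - r.
  move=> rb <-; exact: (@inverse_degree R g br hg t b ht_linear ht_neg hb0
    brD Phi hPhi H hH alpha k hbase sigma h hsigma hW c bc beta m j).
have linear_inverse : (forall j, c j != 0 -> (j <= 1)%N) ->
    exists2 p : {poly R[i]}, (size p <= 2)%N & fps_mul b (fun n => p`_n) = @fps_one R[i].
  move=> cj; exists (\poly_(j < 2) c j); first exact: size_poly.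
  rewrite -bc; congr (fps_mul b _); apply/funext => j; rewrite coef_poly.
  by case: ltnP => // j2; apply/esym/eqP; apply: contraTT j2 => /cj; rewrite -leqNgt.
have [i0|i0] := eqVneq i ord0.
  move: hh; rewrite /vertex_point i0 eqxx => h0; rewrite (base_k0 hbase); split=> // _.
  have r0 : (- alpha ord0) h = 0 by rewrite h0 linear0.
  apply: linear_inverse => j cj.
  (* For beta(h) = 0 the choice m = 0 gives j - 1 <= 0. *)
  have m0 (n : int) : n%:~R <= (0 : R[i]) -> n <= - 0 by rewrite lerz0 oppr0.
  by have := deg _ _ 0 j (base_max_root hbase) r0 m0 cj; rewrite oppr0 lerz0; lia.
have [l il _] : {l | i = lift ord0 l & unlift ord0 i = Some l}.
  by apply: unlift_some; rewrite eq_sym.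
have ri := base_roots hbase l; rewrite -il in ri.
have hi : alpha i h = (k i)%:R^-1.
  by move: hh; rewrite /vertex_point (negPf i0) => /(_ _ i0) ->; rewrite eqxx div1r.
split=> [k1|k1].
  rewrite k1 invr1 in hi; apply: linear_inverse => j cj.
  (* For beta(h) = 1 the choice m = -1 gives j - 2 <= -1. *)
  have m1 (n : int) : n%:~R <= (1 : R[i]) -> n <= - (-1) by rewrite opprK (ler_int _ n 1).
  by have := deg _ _ (-1) j ri hi m1 cj; rewrite (ler_int _ _ (-1)); lia.
have c0 j : c j != 0 -> j = 0%N.
  move=> cj; have k0 : (0 : R[i]) < (k i)%:R^-1 by rewrite invr_gt0 ltr0n; lia.
  have k_lt1 : (k i)%:R^-1 < 1 :> R[i] by rewrite invf_lt1 ?ltr0n ?ltr1n //; lia.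
  (* An integer at most 1/k_i < 1 is at most 0, so m = 0 is allowed, and j - 1 <= -1/k_i < 0 forces
     j = 0. *)
  have m0 (n : int) : n%:~R <= (k i)%:R^-1 :> R[i] -> n <= - 0.
    by move=> nk; have := le_lt_trans nk k_lt1; rewrite (ltr_int _ n 1); lia.
  have jk := deg _ _ 0 j ri hi m0 cj.
  have : (0 - 1 + j%:Z)%:~R < (0 : R[i]) by rewrite (le_lt_trans jk) // oppr_lt0.
  by rewrite ltrz0; lia.
(* Thus 1/b is the constant c_0, and b_0 = 1 makes it 1. *)
have cE : c = fun j => if j == 0%N then c 0%N else 0.
  apply/funext => j; case: eqP => [->//|/eqP j0]; apply/eqP.
  by apply: contraNT j0 => /c0 ->.
have bE n : fps_mul b c n = b n * c 0%N.
  rewrite /fps_mul /fps_conv big_ord_recr /= subnn big1 ?add0r // => -[q /= qn] _.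
  by rewrite cE subn_eq0 leqNgt qn mulr0.
have c01 : c 0%N = 1 by have := bE 0%N; rewrite bc hb0 mul1r.
by apply/funext => n; rewrite -bc bE c01 mulr1.
Qed.
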